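(* Let $d\geq 2$ be an integer and let $G=(V,E)$ be a finite simple $d$-regular graph. Then $G$ admits a vertex-colouring edge $4$-weighting, i.e. there exists $\omega:E\to\{1,2,3,4\}$ such that $\sigma_\omega(u)\neq\sigma_\omega(v)$ for every edge $uv\in E$, where $\sigma_\omega(v):=\sum_{u\in N(v)}\omega(uv)$.
   Context: For a graph $G=(V,E)$, an edge $k$-weighting is a map $\omega:E\to\{1,2,\ldots,k\}$; the weighted degree (sum) of a vertex $v$ is $\sigma_\omega(v)=\sum_{u\in N(v)}\omega(uv)$, where $N(v)$ is the set of neighbours of $v$. The weighting is vertex-colouring if adjacent vertices have distinct sums. *)

(* Defs.v *)
(* A finite simple graph on the vertex type T is a symmetric
   irreflexive adjacency relation e : rel T. *)
From mathcomp Require Import all_boot.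
Set Implicit Arguments.
Unset Strict Implicit.
Unset Printing Implicit Defensive.

Section Graph.
Variables (T : finType) (e : rel T).

Definition simple_graph : Prop := symmetric e /\ irreflexive e.

Definition edges : {set {set T}} := [set [set u; v] | u in T, v in T & e u v].

Definition neighbours (v : T) : {set T} := [set u | e v u].

Definition regular (d : nat) : Prop := forall v, #|neighbours v| = d.

(* A weighting is a map on vertex sets, of which only the values on edges
   are constrained and used. *)
Definition edge_weighting (k : nat) (w : {set T} -> nat) : Prop :=
  {in edges, forall A, 1 <= w A <= k}.

Definition wdeg (w : {set T} -> nat) (v : T) : nat :=
  \sum_(u in neighbours v) w [set u; v].

Definition vertex_colouring (w : {set T} -> nat) : Prop :=
  forall u v, e u v -> wdeg w u <> wdeg w v.

End Graph.

(* Main.v *)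
Require Import Defs.
From mathcomp Require Import all_boot zify.

(** Fix a maximal independent set I, let S be the set of isolated vertices of
    the graph induced on the complement of I, and A the remaining vertices, so
    that the only edges are inside A, between A and I, and between S and I.

    Kalkowski's greedy argument gives weights 2, 3, 4 inside A and 1, 2 between
    A and I (all equal to 2 but one selected edge at each vertex of A), for
    which the sums in A are proper and exceed 2d.

    The edges between S and I first get weights 1 and 2 with every sum in I
    even.  Take such a weighting with the fewest even sums in S: then no two
    even vertices of S have a common neighbour.  At an even vertex v of S,
    adding 2 to the weight of each edge vu for which u has sum less than 2d
    brings the sum of v above 2d and keeps the sums in I even and at most 2d.
    This fails only if all neighbours of v have sum exactly 2d; with the number
    of such v also minimal, v is the only S-neighbour of each of its neighbours,
    and giving weight 1 to two of its edges suffices. *)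

(** * Elementary counting in finite sets *)

Lemma exists_subset_card (T : finType) (B : {set T}) (k : nat) :
  k <= #|B| -> exists2 K : {set T}, K \subset B & #|K| = k.
Proof.
move=> kB; exists [set x in take k (enum B)].
  by apply/subsetP=> x; rewrite inE => /mem_take; rewrite mem_enum.
rewrite cardsE (card_uniqP _) ?take_uniq ?enum_uniq // size_take_min -cardE.
exact/minn_idPl.
Qed.

(** Pigeonhole: the #|B|+1 consecutive values starting at [m] cannot all be among the at most #|B|
    values of [f] on [B]. *)
Lemma exists_shift_notin (T : finType) (B : {set T}) (f : T -> nat) (m : nat) :
  exists2 k, k <= #|B| & forall x, x \in B -> f x <> m + k.
Proof.
pose s := [seq m + k | k <- iota 0 #|B|.+1].
have [/allP sB | /allPn [n /mapP[k kB ->]]] :=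
  boolP (all [in [seq f x | x <- enum B]] s).
  have: size s <= size [seq f x | x <- enum B].
    by apply: uniq_leq_size sB; rewrite map_inj_uniq ?iota_uniq //; apply: addnI.
  by rewrite !size_map size_iota -cardE ltnn.
move=> nfk; exists k; first by move: kB; rewrite mem_iota.
by move=> x xB fx; case/negP: nfk; rewrite -fx map_f ?mem_enum.
Qed.

(** * Greedy weighting of the graph induced on A *)

Section PartialColouring.
Variables (T : finType) (e : rel T) (A : {set T}) (c : T -> nat).
Hypotheses (esym : symmetric e) (eirr : irreflexive e).

(* t v is the excess over 1 of the weight of the selected edge from v to I, and
   c v the rest of the contribution of I to the sum of v. *)
Definition total_sum (h : T -> T -> nat) (t : T -> bool) (v : T) :=
  \sum_(w in A | e v w) h v w + t v + c v.

(** [P] is the set of vertices already treated; pairs with an untreated end keep the neutral weight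
    3, which can still move by one either way. [pc_large] is what later pushes the sums in [A] above
    2d. *)
Record partial_colouring (P : {set T}) h t : Prop := PartialColouring {
  pc_sub : P \subset A;
  pc_sym : forall x y, h x y = h y x;
  pc_bound : forall x y, 2 <= h x y <= 4;
  pc_fresh : forall x y, x \notin P -> h x y = 3;
  pc_large : forall v, v \in P ->
    2 * #|[set w in A | e v w]| + 2 + c v <= total_sum h t v;
  pc_proper : forall u v, u \in P -> v \in P -> e u v ->
    total_sum h t u <> total_sum h t v }.

Lemma partial_colouring0 : partial_colouring set0 (fun _ _ => 3) xpredT.
Proof. by split=> // [|v|u v]; rewrite ?sub0set ?inE. Qed.

(* Changing the weight of a backward edge wv by one is compensated by t w, so
   it moves the total of v but not that of w.  With B the set of backward
   neighbours this gives #|B|.+1 consecutive values for the total of v. *)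
Lemma partial_colouring_step P h t v w0 :
    partial_colouring P h t -> v \in A -> v \notin P ->
    w0 \in A -> e v w0 -> (w0 \notin P) || t w0 ->
  exists h' t', partial_colouring (v |: P) h' t' /\ t' v.
Proof.
move=> [PA hsym hbd hfr hlg hpr] vA vP w0A vw0 w0P.
pose B := [set w in P | e v w].
have BP w : w \in B -> w \in P by rewrite inE => /andP[].
have Bv w : w \in B -> w == v = false.
  by move=> /BP wP; apply: contraNF vP => /eqP <-.
have vB : v \in B = false by rewrite inE (negbTE vP).
(* For a backward neighbour w, [q w] is the smaller of the two weights of vw that a change of [t w]
   can compensate; [K] collects those w that take the larger one. [M] is the total of v when [K] is
   empty and [t' v] holds. *)
pose q w := if w \in B then 2 + t w else 3.
pose M := \sum_(w in A | e v w) q w + 1 + c v.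
have [k kB kf] := exists_shift_notin _ B (total_sum h t) M.
have [K KB cK] := exists_subset_card _ B k kB.
have KB' w : w \in K -> w \in B by apply: (subsetP KB).
pose h' x y := if (x == v) && (y \in B) then 2 + t y + (y \in K) else
               if (y == v) && (x \in B) then 2 + t x + (x \in K) else h x y.
pose t' x := if x == v then true else if x \in B then x \notin K else t x.
have h'v w : h' v w = q w + (w \in K).
  rewrite /h' /q eqxx vB andbF /=; case: ifP => // nB.
  by rewrite hfr // (contraFF (@KB' w) nB).
have sumv : total_sum h' t' v = M + k.
  rewrite /total_sum /t' eqxx /M.
  rewrite (eq_bigr (fun w => q w + (w \in K))) => [|w _]; last exact: h'v.
  rewrite big_split /= -cK.
  suff -> : \sum_(w in A | e v w) (w \in K) = #|K| by clear; lia.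
  rewrite -sum1_card -[LHS]big_mkcondr; apply: eq_bigl => w.
  case wK: (w \in K); rewrite ?andbF ?andbT //.
  move: (KB' _ wK); rewrite inE => /andP[/(subsetP PA) -> ->] //.
have sumP w : w \in P -> total_sum h' t' w = total_sum h t w.
  move=> wP; have wv : w == v = false by apply: contraNF vP => /eqP <-.
  rewrite /total_sum /t' wv; case: ifP => wB; last first.
    congr (_ + _ + _); apply: eq_bigr => y _.
    by rewrite /h' wv wB andbF.
  have vw : (v \in A) && e w v.
    by rewrite vA esym; move: wB; rewrite inE => /andP[].
  rewrite (bigD1 v vw) [in RHS](bigD1 v vw) /=.
  rewrite [\sum_(_ | _) h' _ _](eq_bigr (fun y => h w y)); last first.
    by move=> y /andP[_ yv]; rewrite /h' wv (negbTE yv).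
  rewrite [h' w v]/h' wv eqxx wB /= [h w v]hsym hfr //.
  by case: (t w); case: (w \in K); clear; lia.
(* Each edge contributes at least 2. The extra 2 comes from [w0], whose edge has [q w0] = 3, and
   from [t' v]. *)
have Mlarge : 2 * #|[set w in A | e v w]| + 2 + c v <= M.
  have pw0 : (w0 \in A) && e v w0 by rewrite w0A.
  rewrite /M leq_add2r cardsE -sum1_card big_distrr /=.
  rewrite !(bigD1 w0 pw0) /=.
  have q0 : q w0 = 3.
    by rewrite /q; case: ifP => // /BP w0P'; move: w0P; rewrite w0P' /= => ->.
  rewrite q0 addnAC [leqRHS]addnAC leq_add //; apply: leq_sum => i _.
  by rewrite /q; case: ifP.
exists h', t'; split; last by rewrite /t' eqxx.
split.
- by rewrite subUset sub1set vA.
- move=> x y; rewrite /h' (hsym x y).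
  case: (x =P v) => [->|_]; case: (y =P v) => [->|_] //=; by rewrite ?vB.
- move=> x y; rewrite /h'; case: ifP => _; last case: ifP => _ //.
    by case: (t y); case: (y \in K).
  by case: (t x); case: (x \in K).
- move=> x y; rewrite inE negb_or inE => /andP[/negbTE xv xP].
  rewrite /h' xv /= hfr //; case: ifP => // /andP[_ /BP].
  by rewrite (negbTE xP).
- move=> x; rewrite in_setU1 => /predU1P[->|xP]; last by rewrite sumP // hlg.
  by rewrite sumv; apply: leq_trans Mlarge (leq_addr _ _).
- have vx x : x \in P -> e v x -> total_sum h t x <> M + k.
    by move=> xP vx; apply: kf; rewrite inE xP.
  move=> x y; rewrite in_setU1 => /predU1P[->|xP]; rewrite in_setU1 => /predU1P[->|yP].
  + by rewrite eirr.
  + by rewrite sumv sumP // => /(vx _ yP) /nesym.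
  + by rewrite sumv sumP // esym => /(vx _ xP).
  + by rewrite !sumP //; apply: hpr.
Qed.

(** Invariant of the greedy order: every untreated vertex has an untreated neighbour, which serves
    as [w0] in the step. *)
Definition no_isolated (U : {set T}) :=
  forall v, v \in U -> exists2 w, w \in U & e v w.

Lemma no_isolatedP U :
  reflect (no_isolated U) [forall v in U, exists w in U, e v w].
Proof.
apply: (iffP 'forall_in_exists_inP) => U_ v vU; by have [w] := U_ v vU; exists w.
Qed.

(* If no single vertex of U can be removed, then any v together with the
   vertex that its removal isolates is a component of G[U]. *)
Lemma partial_colouring_complete n P h t :
    #|A :\: P| <= n -> partial_colouring P h t -> no_isolated (A :\: P) ->
  exists h' t', partial_colouring A h' t'.
Proof.
elim/ltn_ind: n P h t => n IH P h t Un pc niso.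
have PA := pc_sub _ _ _ pc.
have [U0|[v vU]] := set_0Vmem (A :\: P).
  exists h, t; suff -> : A = P by [].
  by apply/eqP; rewrite eqEsubset PA -setD_eq0 U0 eqxx.
have setDU1 (x : T) (Q : {set T}) : A :\: (x |: Q) = (A :\: Q) :\ x.
  by rewrite setUC setDDl.
have shrink (x : T) (Q : {set T}) : x \in A :\: Q ->
    #|A :\: (x |: Q)| < #|A :\: Q|.
  by move=> xU; rewrite setDU1 [X in _ < X](cardsD1 x) xU.
case: (boolP [exists z in A :\: P,
    [forall v in (A :\: P) :\ z, exists w in (A :\: P) :\ z, e v w]]).
  case/exists_inP=> z zU /no_isolatedP; rewrite -setDU1 => niso'.
  have [w wU zw] := niso z zU.
  have := zU; rewrite inE => /andP[zP zA]; move: wU; rewrite inE => /andP[wP wA].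
  have [|h' [t' [pc' _]]] := partial_colouring_step _ _ _ _ w pc zA zP wA zw; first by rewrite wP.
  by apply: (IH _ _ _ h' t' (leqnn _) pc' niso'); apply: leq_trans Un; apply: shrink.
rewrite negb_exists_in => /forall_inP crit.
have critical z : z \in A :\: P ->
    exists2 y, y \in (A :\: P) :\ z & forall w, w \in A :\: P -> e y w -> w = z.
  move=> zU; have := crit z zU; rewrite negb_forall_in => /exists_inP[y yU].
  rewrite negb_exists_in => /forall_inP yN; exists y => // w wU yw.
  by apply/eqP/negPn/negP => wz; have := yN w; rewrite yw !inE wz -in_setD wU => /(_ isT).
have [y] := critical v vU; rewrite !inE => /and3P[yv yP yA] yN.
have yU : y \in A :\: P by rewrite inE yP.
have [w wU yw] := niso y yU; have wv := yN w wU yw; rewrite {w wU}wv in yw.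
have [x] := critical y yU; rewrite in_setD1 => /andP[xy xU] xN.
have [w wU xw] := niso x xU; have wy := xN w wU xw; rewrite {w wU}wy in xw.
have xv : x = v by apply: yN => //; rewrite esym.
rewrite {x xU xy}xv in xN xw.
have := vU; rewrite inE => /andP[vP vA].
(* The component {v, y} is treated as a pair: v first, with y untreated as its [w0], then y with v
   as its [w0], since [t1 v] has just been set. *)
have [|h1 [t1 [pc1 t1v]]] := partial_colouring_step _ _ _ _ y pc vA vP yA xw; first by rewrite yP.
have yP1 : y \notin v |: P by rewrite !inE negb_or yv.
have [|h2 [t2 [pc2 _]]] := partial_colouring_step _ _ _ _ v pc1 yA yP1 vA yw; first by rewrite t1v orbT.
apply: (IH _ _ _ h2 t2 (leqnn _) pc2).
  apply: leq_trans Un; apply: ltn_trans (shrink v P vU); apply: shrink.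
  by rewrite inE yP1.
move=> z; rewrite !inE !negb_or => /andP[/and3P[zy zv zP] zA].
have zU : z \in A :\: P by rewrite inE zP.
have [w wU zw] := niso z zU; exists w => //.
move: (wU); rewrite !inE !negb_or => /andP[-> ->]; rewrite !andbT; apply/andP; split.
  by apply: contraNneq zv => wy; apply/eqP/yN => //; rewrite esym -wy.
by apply: contraNneq zy => wv; apply/eqP/xN => //; rewrite esym -wv.
Qed.

Lemma exists_total_colouring :
  no_isolated A -> exists h t, partial_colouring A h t.
Proof.
move=> niso; apply: (partial_colouring_complete _ _ _ _ (leqnn _) partial_colouring0).
by rewrite setD0.
Qed.

End PartialColouring.

(** * Weights 1 and 2 between S and I, and their parities *)

Lemma odd_sum_flip (T : finType) (P : pred T) (F F' : T -> nat) (j : T) :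
    P j -> (forall i, i != j -> F' i = F i) -> odd (F' j) = ~~ odd (F j) ->
  odd (\sum_(i | P i) F' i) = ~~ odd (\sum_(i | P i) F i).
Proof.
move=> Pj FF' oF; rewrite !(bigD1 j Pj) /= !oddD oF addNb; congr (~~ (_ (+) odd _)).
by apply: eq_bigr => i /andP[_ /FF'].
Qed.

Section Bipartite.
(* x u is the contribution to the sum of u of its neighbours outside S. *)
Variables (T : finType) (e : rel T) (S I : {set T}) (x : T -> nat) (d : nat).
Hypothesis d_ge2 : 2 <= d.
Hypothesis degS : forall v, v \in S -> #|[set u in I | e v u]| = d.
Hypothesis degI : forall u, u \in I ->
  x u + 2 * #|[set v in S | e v u]| <= 2 * d.

Definition sumS (k : T -> T -> nat) v := \sum_(u in I | e v u) k v u.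
Definition sumI (k : T -> T -> nat) u := x u + \sum_(v in S | e v u) k v u.

(** Recording the pairs of weight 1 as a finite set makes the weightings a finite type, over which
    minima exist. *)
Definition wt12 (g : {set T * T}) (v u : T) := if (v, u) \in g then 1 else 2.

Definition toggle (g : {set T * T}) p := [set q | (q \in g) (+) (q == p)].

Lemma wt12_toggle g v u v' u' : (v', u') != (v, u) ->
  wt12 (toggle g (v, u)) v' u' = wt12 g v' u'.
Proof. by move=> /negbTE ne; rewrite /wt12 inE ne addbF. Qed.

Lemma odd_wt12_toggle g v u :
  odd (wt12 (toggle g (v, u)) v u) = ~~ odd (wt12 g v u).
Proof. by rewrite /wt12 inE eqxx addbT; case: (_ \in g). Qed.

Lemma sumS_toggle_neq g v u v' :
  v' != v -> sumS (wt12 (toggle g (v, u))) v' = sumS (wt12 g) v'.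
Proof.
move=> ne; apply: eq_bigr => u' _; apply: wt12_toggle.
by rewrite xpair_eqE negb_and ne.
Qed.

Lemma sumI_toggle_neq g v u u' :
  u' != u -> sumI (wt12 (toggle g (v, u))) u' = sumI (wt12 g) u'.
Proof.
move=> ne; congr (_ + _); apply: eq_bigr => v' _; apply: wt12_toggle.
by rewrite xpair_eqE negb_and ne orbT.
Qed.

Lemma odd_sumS_toggle g v u : u \in I -> e v u ->
  odd (sumS (wt12 (toggle g (v, u))) v) = ~~ odd (sumS (wt12 g) v).
Proof.
move=> uI vu; apply: (odd_sum_flip _ _ _ _ u); rewrite ?uI ?odd_wt12_toggle //.
by move=> u' ne; apply: wt12_toggle; rewrite xpair_eqE negb_and ne orbT.
Qed.

Lemma odd_sumI_toggle g v u : v \in S -> e v u ->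
  odd (sumI (wt12 (toggle g (v, u))) u) = ~~ odd (sumI (wt12 g) u).
Proof.
move=> vS vu; rewrite !oddD -addbN; congr (_ (+) _).
apply: (odd_sum_flip _ _ (fun v => wt12 g v u) (fun v' => wt12 (toggle g (v, u)) v' u) v);
  rewrite ?vS ?odd_wt12_toggle //.
by move=> v' ne; apply: wt12_toggle; rewrite xpair_eqE negb_and ne.
Qed.

Lemma wt12_bound g v u : 1 <= wt12 g v u <= 2.
Proof. by rewrite /wt12; case: ifP. Qed.

Lemma sumI_le g u : u \in I -> sumI (wt12 g) u <= 2 * d.
Proof.
move=> uI; apply: leq_trans (degI _ uI); rewrite leq_add2l cardsE -sum1_card.
by rewrite big_distrr; apply: leq_sum => v _; case/andP: (wt12_bound g v u).
Qed.

(** By [degI] the value 2d is reached only if every edge from u to [S] has its maximal weight 2. *)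
Lemma sumI_full g u v : u \in I -> v \in S -> e v u ->
  sumI (wt12 g) u = 2 * d -> (v, u) \notin g.
Proof.
move=> uI vS vu full; apply/negP => vug.
have Pv : (v \in S) && e v u by rewrite vS.
have := degI _ uI; rewrite -full /sumI leq_add2l cardsE -sum1_card big_distrr.
rewrite !(bigD1 v Pv) /= {1}/wt12 vug.
suff le : \sum_(i in S | e i u && (i != v)) wt12 g i u <=
          \sum_(i in S | e i u && (i != v)) 2 * 1.
  under eq_bigl do rewrite -andbA.
  under [in X in _ <= X]eq_bigl do rewrite -andbA.
  by rewrite leqNgt ltnS => /negP; apply; apply: leq_ltn_trans le _.
by apply: leq_sum => i _; case/andP: (wt12_bound g i u).
Qed.

(** Only these vertices of [I] can have their parity corrected by a toggle; the sum of any other is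
    the fixed number [x u]. *)
Definition active := [set u in I | [exists v in S, e v u]].

Lemma activeP u : reflect (u \in I /\ exists2 v, v \in S & e v u) (u \in active).
Proof.
rewrite inE; apply: (iffP andP) => -[uI ex]; split=> //; exact/exists_inP.
Qed.

Definition evenI g := [forall u in active, ~~ odd (sumI (wt12 g) u)].

(** Minimise the number of odd active vertices: toggling an edge from [S] at an odd u corrects u and
    affects no other sum in [I]. *)
Lemma exists_evenI : exists g, evenI g.
Proof.
pose N g := #|[set u in active | odd (sumI (wt12 g) u)]|.
case: (arg_minnP (P := xpredT) N (i0 := set0)) => // g _ gmin.
exists g; apply/forall_inP => u ua; apply/negP => uodd.
have [uI [v vS vu]] := activeP _ ua.
have := gmin (toggle g (v, u)) isT; rewrite leqNgt => /negP; apply.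
apply/proper_card/properP; split.
  apply/subsetP => u'; rewrite !inE => /andP[->] /=.
  by have [->|ne] := eqVneq u' u; [rewrite uodd | rewrite sumI_toggle_neq].
by exists u; rewrite in_set ua ?odd_sumI_toggle ?uodd.
Qed.

Definition evenS g := [set v in S | ~~ odd (sumS (wt12 g) v)].

Definition stuck g :=
  [set v in evenS g | [forall u in I, e v u ==> (sumI (wt12 g) u == 2 * d)]].

Lemma stuckP g v : reflect
  (v \in evenS g /\ forall u, u \in I -> e v u -> sumI (wt12 g) u = 2 * d)
  (v \in stuck g).
Proof.
rewrite [in X in reflect _ X]inE; apply: (iffP andP) => -[vW all2d]; split=> //.
  by move=> u uI vu; apply/eqP; move/forall_inP: all2d => /(_ u uI)/implyP; apply.
by apply/forall_inP => u uI; apply/implyP => vu; apply/eqP/all2d.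
Qed.

(** Lexicographic order on the pair (#|evenS g|, #|stuck g|), as the second entry is at most
    #|T|. *)
Definition potential g := #|evenS g| * #|T|.+1 + #|stuck g|.

(** Toggling two edges at u flips the parities of v1 and v2 while keeping that of u. *)
Definition toggle2 g v1 v2 u := toggle (toggle g (v1, u)) (v2, u).

Section Toggle2.
Variables (g : {set T * T}) (v1 v2 u : T).
Hypotheses (v1S : v1 \in S) (v2S : v2 \in S) (uI : u \in I).
Hypotheses (v1u : e v1 u) (v2u : e v2 u) (v12 : v1 != v2).

Lemma evenI_toggle2 : evenI g -> evenI (toggle2 g v1 v2 u).
Proof.
move=> /forall_inP ev; apply/forall_inP => u' ua; have := ev u' ua.
have [->|ne] := eqVneq u' u; last by rewrite !sumI_toggle_neq.
by rewrite !odd_sumI_toggle // negbK.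
Qed.

Lemma evenS_toggle2 v : v \in S ->
  v \in evenS (toggle2 g v1 v2 u) = (v \in evenS g) (+) (v \in [set v1; v2]).
Proof.
move=> vS; rewrite !inE vS /=.
have [->|ne2] := eqVneq v v2.
  by rewrite odd_sumS_toggle // sumS_toggle_neq 1?eq_sym // orbT addbT.
rewrite sumS_toggle_neq //; have [->|ne1] := eqVneq v v1.
  by rewrite odd_sumS_toggle // addbT.
by rewrite sumS_toggle_neq // addbF.
Qed.

End Toggle2.

(** * Structure of a weighting of minimal potential *)

Section Minimal.
Variable g : {set T * T}.
Hypothesis g_even : evenI g.
Hypothesis g_min : forall g', evenI g' -> potential g <= potential g'.

Lemma evenS_S v : v \in evenS g -> v \in S.
Proof. by rewrite inE => /andP[]. Qed.

(** Otherwise [toggle2] would make both vertices odd and lower the potential. *)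
Lemma evenS_no_common_neighbour v1 v2 u :
  v1 \in evenS g -> v2 \in evenS g -> u \in I -> e v1 u -> e v2 u -> v1 = v2.
Proof.
move=> v1W v2W uI v1u v2u; apply/eqP/negPn/negP => v12.
have v1S := evenS_S _ v1W; have v2S := evenS_S _ v2W.
have := g_min _ (evenI_toggle2 g _ _ _ v1S v2S v1u v2u g_even).
suff /proper_card lt : evenS (toggle2 g v1 v2 u) \proper evenS g.
  rewrite leqNgt => /negP; apply; rewrite /potential.
  apply: (@leq_trans (#|evenS g| * #|T|.+1)); last exact: leq_addr.
  apply: leq_trans (leq_mul lt (leqnn _)); rewrite mulSn addnC ltn_add2r ltnS.
  exact: max_card.
apply/properP; split; last first.
  by exists v1 => //; rewrite evenS_toggle2 // v1W !inE eqxx.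
apply/subsetP => v vW; have vS : v \in S by move: vW; rewrite inE => /andP[].
move: vW; rewrite evenS_toggle2 //; case: (boolP (v \in [set v1; v2])).
  by rewrite in_set2 => /orP[]/eqP ->; rewrite ?v1W ?v2W.
by rewrite addbF.
Qed.

(* Otherwise the parity defect of v can be moved to a second S-neighbour of u;
   there it is not stuck, because the edge uv now has weight 1. *)
Lemma stuck_private_neighbour v v' u :
  v \in stuck g -> u \in I -> e v u -> v' \in S -> e v' u -> v' = v.
Proof.
move=> vB uI vu v'S v'u; apply/eqP/negPn/negP => ne.
have [vW vfull] := stuckP _ _ vB; have vS := evenS_S _ vW.
have v'W : v' \notin evenS g.
  by apply: contraNN ne => v'W; apply/eqP/(evenS_no_common_neighbour _ _ u).
have := ne; rewrite eq_sym => ne'.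
set g' := toggle2 g v v' u.
have := g_min _ (evenI_toggle2 g _ _ _ vS v'S vu v'u g_even); rewrite -/g'.
have W'E : evenS g' = v' |: evenS g :\ v.
  apply/setP => y; rewrite in_setU1 in_setD1.
  case: (boolP (y \in S)) => yS; last first.
    have nW h : (y \in evenS h) = false by rewrite inE (negbTE yS).
    by rewrite !nW andbF orbF; apply/esym; apply: contraNF yS => /eqP ->.
  rewrite evenS_toggle2 // in_set2.
  have [->|yv] := eqVneq y v; first by rewrite vW (negbTE ne').
  have [->|yv'] := eqVneq y v'; first by rewrite (negbTE v'W).
  by rewrite addbF.
have cW : #|evenS g'| = #|evenS g|.
  rewrite W'E cardsU1 [in RHS](cardsD1 v) vW.
  by rewrite in_setD1 negb_and v'W orbT.
rewrite /potential cW leq_add2l leqNgt => /negP; apply.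
apply: proper_card; apply/properP; split; last first.
  by exists v => //; apply/negP => /stuckP[]; rewrite W'E !inE eqxx (negbTE ne').
have vug : (v, u) \notin g by apply: sumI_full => //; apply: vfull.
have unfull : sumI (wt12 g') u <> 2 * d.
  move=> /(sumI_full _ _ v uI vS vu); apply/negP.
  by rewrite negbK !inE (negbTE vug) eqxx xpair_eqE (negbTE ne').
(* No neighbour of u is stuck for [g'], so the neighbours of a stuck y differ from u and have the
   same sums under [g]. *)
apply/subsetP => y /stuckP[yW' yfull].
have yu : e y u = false by apply/negP => yu; apply/unfull/yfull.
apply/stuckP; split.
  move: yW'; rewrite W'E in_setU1 => /predU1P[yv'|]; first by rewrite yv' v'u in yu.
  by rewrite in_setD1 => /andP[].
move=> u' u'I yu'; have u'u : u' != u by apply: contraFneq yu => <-.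
by rewrite -(yfull u' u'I yu') !sumI_toggle_neq.
Qed.

(** * Final weights between S and I *)

Definition dropped v := [set u' in take 2 (enum [set u in I | e v u])].

Definition final_weight v u :=
  if v \in stuck g then (if u \in dropped v then 1 else 2) else
  wt12 g v u + (if (v \in evenS g) && (sumI (wt12 g) u < 2 * d) then 2 else 0).

Lemma final_weight_bound v u : 1 <= final_weight v u <= 4.
Proof.
rewrite /final_weight; case: ifP => _; first by case: ifP.
by case: ifP => _; case/andP: (wt12_bound g v u); clear; lia.
Qed.

Lemma sumS_final_odd v : v \notin evenS g ->
  sumS final_weight v = sumS (wt12 g) v.
Proof.
move=> vW; apply: eq_bigr => u _; rewrite /final_weight (negbTE vW) /= addn0.
by rewrite ifN //; apply: contraNN vW => /stuckP[].
Qed.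

Lemma sumS_final_stuck v : v \in stuck g -> sumS final_weight v + 2 = 2 * d.
Proof.
move=> vB; have [/evenS_S vS _] := stuckP _ _ vB.
have cQ : #|dropped v| = 2.
  rewrite cardsE (card_uniqP _) ?take_uniq ?enum_uniq // size_take_min -cardE degS //.
  exact/minn_idPl.
rewrite -[X in _ + X = _]cQ -(degS _ vS) [in RHS]cardsE -!sum1_card big_distrr /=.
rewrite [X in _ + X](_ : _ = \sum_(u in I | e v u) (u \in dropped v)).
  rewrite -big_split; apply: eq_bigr => u _.
  by rewrite /final_weight vB; case: ifP.
rewrite -[RHS]big_mkcondr; apply: eq_bigl => u.
case uQ: (u \in dropped v); rewrite ?andbF ?andbT //.
by move: uQ; rewrite inE => /mem_take; rewrite mem_enum inE => ->.
Qed.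

(** An edge to a full u has weight 2 by [sumI_full], any other has weight at least 1 + 2; since v is
    not stuck, the second kind occurs. *)
Lemma sumS_final_even v : v \in evenS g -> v \notin stuck g ->
  2 * d < sumS final_weight v.
Proof.
move=> vW vB; have vS := evenS_S _ vW.
have : ~~ [forall u in I, e v u ==> (sumI (wt12 g) u == 2 * d)].
  by apply: contraNN vB => full; rewrite in_set vW.
rewrite negb_forall_in => /exists_inP[u0 u0I].
rewrite negb_imply => /andP[vu0 lt0].
have P0 : (u0 \in I) && e v u0 by rewrite u0I.
have lt0' : sumI (wt12 g) u0 < 2 * d by rewrite ltn_neqAle lt0 sumI_le.
rewrite -(degS _ vS) cardsE -sum1_card big_distrr /sumS /=.
rewrite !(bigD1 u0 P0) /= -addSn leq_add //.
  by rewrite /final_weight (negbTE vB) vW lt0' /=; case/andP: (wt12_bound g v u0); clear; lia.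
apply: leq_sum => u /andP[/andP[uI vu] _]; rewrite /final_weight (negbTE vB) vW /=.
case: ltnP => [_|ge]; first by rewrite addnC.
have full : sumI (wt12 g) u = 2 * d by apply/eqP; rewrite eqn_leq ge sumI_le.
by rewrite /wt12 (negbTE (sumI_full _ _ _ uI vS vu full)).
Qed.

(** As v is the only neighbour of u in [S], the sum of u falls from 2d by at most one, which leaves
    it above the final sum 2d - 2 of v. *)
Lemma sumI_final_stuck v u : v \in stuck g -> u \in I -> e v u ->
  2 * d <= (sumI final_weight u).+1 /\ sumI final_weight u <= 2 * d.
Proof.
move=> vB uI vu; have [/evenS_S vS vfull] := stuckP _ _ vB.
have full := vfull u uI vu.
have one (k : T -> T -> nat) : sumI k u = x u + k v u.
  congr (_ + _); apply: big_pred1 => v' /=; apply/andP/eqP => [[v'S v'u]|-> //].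
  exact: (stuck_private_neighbour _ _ u).
move: (full); rewrite !one {1}/wt12 (negbTE (sumI_full _ _ _ uI vS vu full)).
by rewrite /final_weight vB => <-; case: ifP; clear; lia.
Qed.

(** At most one neighbour of u lies in [evenS g], so u gains at most 2, and only from an even value
    below 2d, hence at most 2d - 2. *)
Lemma sumI_final_unstuck u : u \in active ->
    (forall v, v \in stuck g -> ~~ e v u) ->
  ~~ odd (sumI final_weight u) /\ sumI final_weight u <= 2 * d.
Proof.
move=> ua unstuck; have [uI _] := activeP _ ua.
have ev : ~~ odd (sumI (wt12 g) u) by move/forall_inP: g_even => /(_ u ua).
have fwE v : e v u -> final_weight v u =
   wt12 g v u + (if (v \in evenS g) && (sumI (wt12 g) u < 2 * d) then 2 else 0).
  move=> vu; rewrite /final_weight ifN //; apply/negP => /unstuck.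
  by rewrite vu.
case: (pickP [pred v in evenS g | e v u]) => [w /andP[/= wW wu] | noW]; last first.
  suff -> : sumI final_weight u = sumI (wt12 g) u by rewrite sumI_le.
  congr (_ + _); apply: eq_bigr => v /andP[_ vu]; rewrite fwE //.
  by have := noW v; rewrite /= vu andbT => ->; rewrite addn0.
have wS := evenS_S _ wW.
have -> : sumI final_weight u =
    sumI (wt12 g) u + (if sumI (wt12 g) u < 2 * d then 2 else 0).
  have Pw : (w \in S) && e w u by rewrite wS.
  rewrite {1 2}/sumI !(bigD1 w Pw) /= fwE // wW /=.
  rewrite (eq_bigr (fun v => wt12 g v u)) => [|v /andP[/andP[_ vu] vw]].
    by case: ifP => _; clear; lia.
  rewrite fwE // ifN ?addn0 //; apply: contraNN vw => /andP[vW _].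
  by apply/eqP/(evenS_no_common_neighbour _ _ u).
case: ltnP => [lt|_]; last by rewrite addn0 sumI_le.
rewrite oddD addbF; split=> //.
move: ev lt; move: (sumI _ _) => n; clear; lia.
Qed.

Lemma final_weight_le u : u \in I -> sumI final_weight u <= 2 * d.
Proof.
move=> uI; case: (boolP (u \in active)) => [ua | una].
  case: (pickP [pred v in stuck g | e v u]) => [w /andP[/= wB wu] | noB].
    by have [] := sumI_final_stuck _ _ wB uI wu.
  have [] // := sumI_final_unstuck u ua.
  by move=> v vB; have := noB v; rewrite /= vB /= => ->.
apply: leq_trans (degI _ uI); rewrite leq_add2l big_pred0 // => v.
apply: contraNF una => /andP[vS vu]; apply/activeP; split=> //; by exists v.
Qed.

(** A stuck v has sum 2d - 2 against at least 2d - 1, another v in [evenS g] has more than 2d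
    against at most 2d, and any remaining v has an odd sum against an even one. *)
Lemma final_weight_proper v u : v \in S -> u \in I -> e v u ->
  sumS final_weight v <> sumI final_weight u.
Proof.
move=> vS uI vu; case: (boolP (v \in stuck g)) => vB.
  have := sumS_final_stuck _ vB; have [] := sumI_final_stuck _ _ vB uI vu.
  move: (sumS _ _) (sumI _ _); clear; lia.
case: (boolP (v \in evenS g)) => vW.
  have := sumS_final_even _ vW vB; have := final_weight_le _ uI.
  move: (sumS _ _) (sumI _ _); clear; lia.
have ua : u \in active by apply/activeP; split=> //; exists v.
have [w wB|ev _ eq] := sumI_final_unstuck u ua.
  apply: contraNN vB => wu; suff -> : v = w by [].
  exact: (stuck_private_neighbour _ _ u).
by move: ev; rewrite -eq sumS_final_odd //; apply/negP; rewrite negbK; move: vW; rewrite inE vS negbK.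
Qed.

End Minimal.

Lemma exists_bipartite_weighting : exists k : T -> T -> nat,
  [/\ forall v u, 1 <= k v u <= 4,
      forall u, u \in I -> sumI k u <= 2 * d
    & forall v u, v \in S -> u \in I -> e v u -> sumS k v <> sumI k u].
Proof.
have [g0 ev0] := exists_evenI.
case: (arg_minnP (P := evenI) potential ev0) => g ev gmin.
exists (final_weight g); split.
- exact: final_weight_bound.
- exact: final_weight_le.
- exact: final_weight_proper.
Qed.

End Bipartite.

(** * Assembling the weighting of the whole graph *)

(** By symmetry of [W], the ordered pair picked to represent a set does not matter; the value 0 is
    only taken on sets that are not of the form {x, y}. *)
Lemma weighting_of_symmetric (T : finType) (W : T -> T -> nat) :
    (forall x y, W x y = W y x) ->
  exists w : {set T} -> nat, forall x y, w [set x; y] = W x y.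
Proof.
move=> Wsym; exists (fun B => if [pick p : T * T | B == [set p.1; p.2]] is Some p
                              then W p.1 p.2 else 0) => x y.
case: pickP => [[a b] /= /eqP E | /(_ (x, y))]; last by rewrite eqxx.
have := set21 x y; rewrite E in_set2; have := set22 x y; rewrite E in_set2.
have := set21 a b; rewrite -E in_set2; have := set22 a b; rewrite -E in_set2.
by do 4![case/orP=> /eqP ?]; subst.
Qed.

Lemma exists_maximal_independent (T : finType) (e : rel T) : irreflexive e ->
  exists I : {set T}, {in I &, forall u v, ~~ e u v} /\
    forall v, v \notin I -> exists2 u, u \in I & e v u || e u v.
Proof.
move=> eirr; pose indep (I : {set T}) := [forall u in I, forall v in I, ~~ e u v].
have indepP (I : {set T}) : reflect {in I &, forall u v, ~~ e u v} (indep I).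
  apply: (iffP 'forall_in_forall_inP) => ind u v *; exact: ind.
have [|I /maxsetP[/indepP ind imax]] := ex_maxset (P := indep).
  by exists set0; apply/indepP => u v; rewrite inE.
exists I; split=> // v vI; apply/exists_inP; apply: contraNT vI.
rewrite negb_exists_in => /forall_inP none.
rewrite -(imax (v |: I) _ (subsetUr _ _)) ?setU11 //; apply/indepP => a b.
rewrite !in_setU1 => /predU1P[->|aI] /predU1P[->|bI]; first by rewrite eirr.
- by have := none b bI; rewrite negb_or => /andP[].
- by have := none a aI; rewrite negb_or => /andP[].
- exact: ind.
Qed.

Theorem theorem2 (d : nat) (hd : 2 <= d) (T : finType) (e : rel T)
    (hG : simple_graph e) (hreg : regular e d) :
  exists w : {set T} -> nat, edge_weighting e 4 w /\ vertex_colouring e w.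
Proof.
have [esym eirr] := hG.
have [I [indep dom]] := exists_maximal_independent T e eirr.
pose A := [set v | (v \notin I) && [exists w, (w \notin I) && e v w]].
pose S := [set v | (v \notin I) && (v \notin A)].
have nAA v w : v \notin I -> w \notin I -> e v w -> v \in A.
  by move=> vI wI vw; rewrite inE vI; apply/existsP; exists w; rewrite wI.
have niso : no_isolated T e A.
  move=> v; rewrite inE => /andP[vI /existsP[w /andP[wI vw]]].
  by exists w => //; apply: (nAA _ v); rewrite // esym.
have AI v : v \in A -> v \in I = false by rewrite inE => /andP[/negbTE].
have SI v : v \in S -> v \in I = false by rewrite inE => /andP[/negbTE].
have SA v : v \in S -> v \in A = false by rewrite [v \in S]inE => /andP[_ /negbTE].
have IA v : v \in I -> v \in A = false by move=> vI; apply/negP => /AI; rewrite vI.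
have IS v : v \in I -> v \in S = false by move=> vI; apply/negP => /SI; rewrite vI.
have AorS v : v \notin I -> v \notin A -> v \in S by move=> vI vA; rewrite inE vI.
have SnbI v w : v \in S -> e v w -> w \in I.
  move=> vS vw; apply/negPn/negP => wI; have := SA v vS.
  by rewrite (nAA v w) // SI.
have II v w : v \in I -> e v w -> w \in I = false.
  by move=> vI vw; apply/negP => wI; have := indep v w vI wI; rewrite vw.
pose N (B : {set T}) v := #|[set u in B | e v u]|.
have split3 v (F : T -> nat) : \sum_(u | e v u) F u =
    \sum_(u in A | e v u) F u + \sum_(u in I | e v u) F u + \sum_(u in S | e v u) F u.
  rewrite (bigID (mem I)) (bigID (mem A) (fun u => e v u && (u \notin I))) /=.
  rewrite addnCA -addnA; congr (_ + (_ + _)); apply: eq_bigl => u.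
  - by case uA: (u \in A); rewrite ?andbF // (AI _ uA) /= !andbT.
  - exact: andbC.
  - by rewrite [u \in S]inE -andbA andbC.
have degE v : N A v + N I v + N S v = d.
  rewrite -(hreg v) /N !cardsE -!sum1_card -split3; apply: eq_bigl => u //.
have none (B : {set T}) v (F : T -> nat) : (forall w, w \in B -> e v w = false) ->
    \sum_(u in B | e v u) F u = 0.
  by move=> nB; rewrite big_pred0 // => u; apply/andP => -[/nB ->].
have N0 (B : {set T}) v : (forall w, w \in B -> e v w = false) -> N B v = 0.
  by move=> nB; rewrite /N cardsE -sum1_card none.
(* The default v is never taken outside [I], because [I] is maximal. *)
pose sel v := odflt v [pick u in I | e v u].
have selP v : v \notin I -> (sel v \in I) && e v (sel v).
  move=> vI; rewrite /sel; case: pickP => [u //|nou].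
  by have [u uI] := dom v vI; rewrite (esym u) orbb => vu; have := nou u; rewrite /= uI vu.
(* Here [c v] counts 2 for each edge from v to [I] except the selected one, which counts 1; [t v] is
   added separately. *)
have [h [t [_ hsym hbd _ hlarge hproper]]] :=
  exists_total_colouring _ _ _ (fun v => (2 * N I v).-1) esym eirr niso.
pose wI v u := if u == sel v then 1 + t v else 2.
have wI_bd v u : 1 <= wI v u <= 2 by rewrite /wI; case: ifP => // _; case: (t v).
have sum_wI v : v \in A -> \sum_(u in I | e v u) wI v u = t v + (2 * N I v).-1.
  move=> vA; have /selP Psel : v \notin I by rewrite AI.
  rewrite /N cardsE -sum1_card big_distrr /= !(bigD1 (sel v) Psel) /=.
  rewrite {1}/wI eqxx (eq_bigr (fun=> 2 * 1)) => [|u /andP[_ /negbTE ne]].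
    by move: (\sum_(_ | _) _) => m; case: (t v); clear; lia.
  by rewrite /wI ne.
pose x u := \sum_(v in A | e v u) wI v u.
have degS v : v \in S -> #|[set u in I | e v u]| = d.
  move=> vS; rewrite -(degE v) (N0 A) ?(N0 S) ?addn0 // => w wB.
    by apply/negP => /(SnbI _ _ vS) wI'; rewrite IS in wB.
  by apply/negP => /(SnbI _ _ vS) wI'; rewrite IA in wB.
have degI u : u \in I -> x u + 2 * #|[set v in S | e v u]| <= 2 * d.
  move=> uI; rewrite -(degE u) (N0 I) ?addn0; last first.
    by move=> w wI'; apply/negP => /(II _ _ uI); rewrite wI'.
  rewrite mulnDr; apply: leq_add.
    have -> : N A u = #|[set v in A | e v u]|.
      by apply: eq_card => v; rewrite !in_set [e u v]esym.
    rewrite cardsE -sum1_card big_distrr /x.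
    by apply: leq_sum => v _; case/andP: (wI_bd v u).
  rewrite leq_mul2l; apply/eq_leq/eq_card => v.
  by rewrite !in_set [e u v]esym.
have [k [kbd kle kproper]] := exists_bipartite_weighting _ _ _ _ _ _ hd degS degI.
(* The value 1 inside [I] and inside [S] is a default: no edge lies there. *)
pose W a b :=
  if a \in A then (if b \in A then h a b else wI a b) else
  if b \in A then wI b a else
  if a \in I then (if b \in I then 1 else k b a) else
  if b \in I then k a b else 1.
have Wsym a b : W a b = W b a.
  by rewrite /W hsym; case: (a \in A); case: (b \in A); case: (a \in I); case: (b \in I).
have Wbd a b : 1 <= W a b <= 4.
  have := hbd a b; have := wI_bd a b; have := wI_bd b a; have := kbd a b; have := kbd b a.
  by rewrite /W; do ![case: ifP => _]; clear; lia.
have [w wE] := weighting_of_symmetric T W Wsym.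
have sumE v : wdeg e w v = \sum_(u | e v u) W v u.
  by rewrite /wdeg; apply: eq_big => [u|u _]; rewrite ?inE // wE Wsym.
have sumA v : v \in A -> wdeg e w v = total_sum T e A (fun v => (2 * N I v).-1) h t v.
  move=> vA; rewrite sumE split3 [X in _ + X]none ?addn0; last first.
    by move=> u uS; apply/negP; rewrite esym => /(SnbI _ _ uS); rewrite AI.
  rewrite /total_sum -addnA -sum_wI //; congr (_ + _); apply: eq_bigr => u /andP[uB _].
    by rewrite /W vA uB.
  by rewrite /W vA IA.
(* With no neighbour in [S], [pc_large] gives at least 2 N_A + 2 + (2 N_I - 1) = 2d + 1. *)
have sumAgt v : v \in A -> 2 * d < wdeg e w v.
  move=> vA; rewrite sumA //; apply: leq_trans (hlarge v vA).
  have nS0 : N S v = 0.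
    by apply: N0 => u uS; apply/negP; rewrite esym => /(SnbI _ _ uS); rewrite AI.
  have := degE v; rewrite nS0 addn0 -/(N A v).
  have : 0 < N I v.
    by apply/card_gt0P; exists (sel v); rewrite inE; apply: selP; rewrite AI.
  by move: (N A v) (N I v); clear; lia.
have sumSE v : v \in S -> wdeg e w v = sumS T e I k v.
  move=> vS; have nI B : (forall u, u \in B -> u \in I = false) ->
      forall u, u \in B -> e v u = false.
    by move=> BI u /BI uI; apply/negP => /(SnbI _ _ vS); rewrite uI.
  rewrite sumE split3 (none A) ?(none S) ?addn0; [|exact: nI SI|exact: nI AI].
  by apply: eq_bigr => u /andP[uI _]; rewrite /W SA // IA // SI // uI.
have sumIE u : u \in I -> wdeg e w u = sumI T e S x k u.
  move=> uI; rewrite sumE split3 (none I) ?addn0; last first.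
    by move=> v vI; apply/negP => /(II _ _ uI); rewrite vI.
  congr (_ + _); apply: eq_big => v; rewrite ?(esym u) // => /andP[vB _].
    by rewrite /W IA // vB.
  by rewrite /W IA // SA // uI SI.
have sumIle u : u \in I -> wdeg e w u <= 2 * d by move=> uI; rewrite sumIE ?kle.
exists w; split.
  by move=> B /imset2P[a b _ _ ->]; rewrite wE.
(* An edge at [I] ends in [A], where 2d separates the sums, or in [S], where [kproper] applies; all
   other edges lie inside [A]. *)
have properI u v : u \in I -> e u v -> wdeg e w u <> wdeg e w v.
  move=> uI uv; case vA: (v \in A).
    by have := sumAgt v vA; have := sumIle u uI; clear; lia.
  have vS : v \in S by apply: AorS; rewrite ?vA // (II u).
  by rewrite (sumSE v vS) (sumIE u uI); apply/nesym/kproper; rewrite // esym.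
move=> u v uv; case uI: (u \in I); first exact: properI.
case vI: (v \in I); first by apply/nesym/properI; rewrite // esym.
have uA : u \in A by apply: (nAA u v); rewrite ?uI ?vI.
have vA : v \in A by apply: (nAA v u); rewrite ?uI ?vI // esym.
by rewrite !sumA //; apply: hproper.
Qed.
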